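(* Let $q$ be a prime power. Infinite (strictly) ascending chains of monomial clones on $\mathbb{F}_q$ (with respect to inclusion) exist if and only if $q-1$ is not square-free.
   Context: $\mathbb{N}=\{1,2,\dots\}$, $\mathbb{N}_0=\mathbb{N}\cup\{0\}$, $\mathbb{F}_q$ is the field with $q$ elements. A monomial is a formal product $g=\prod_{i\in\mathbb{N}}x_i^{\alpha(i)}$ with $\alpha(i)\in\mathbb{N}_0$, finitely many but at least one $\alpha(i)$ nonzero (so $1$ is not a monomial); $\mathrm{mI}(g)$ is the largest $i$ with $\alpha(i)\neq0$, called the arity of $g$. For $n\ge\mathrm{mI}(g)$ the $n$-ary induced function is $g^{\mathbb{F}_q^n}\colon\mathbb{F}_q^n\to\mathbb{F}_q$, $(x_1,\dots,x_n)\mapsto\prod_{i=1}^nx_i^{\alpha(i)}$. Monomials $m_1,m_2$ are equivalent if the $\mathrm{mI}(m_1)$-ary induced function of $m_1$ equals the $\mathrm{mI}(m_2)$-ary induced function of $m_2$ (i.e. for each $i$ the exponents of $x_i$ in $m_1$ and $m_2$ are equal, or both positive and congruent modulo $q-1$). A clone on a set $A$ is a set of finitary operations on $A$ (of arities $\ge1$) containing all projections and closed under composition. A set $M$ of monomials is a monomial clone on $\mathbb{F}_q$ if $\{m^{\mathbb{F}_q^n}\mid m\in M,\ n\ge\mathrm{mI}(m)\}$ is a clone on $\mathbb{F}_q$ and $M$ is closed under equivalent monomials. *)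

(* Defs.v *)
From HB Require Import structures.
From mathcomp Require Import all_boot all_order all_algebra.
From mathcomp Require Import finmap.
From mathcomp Require Import monalg.
From mathcomp Require Import classical_sets.

Set Implicit Arguments.
Unset Strict Implicit.
Unset Printing Implicit Defensive.

Import GRing.Theory.

Local Open Scope classical_set_scope.

(* Finitary operations of all arities; nullary ones are excluded from clones
   by [is_clone]. *)
Definition operation (A : Type) : Type := {n : nat & n.-tuple A -> A}.

Definition arity (A : Type) (f : operation A) : nat := projT1 f.

Definition op (A : Type) (n : nat) (f : n.-tuple A -> A) : operation A :=
  existT (fun n => n.-tuple A -> A) n f.

Definition projection (A : Type) (n : nat) (i : 'I_n) : n.-tuple A -> A :=
  fun x => tnth x i.

Definition composition (A : Type) (n k : nat) (f : n.-tuple A -> A)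
    (g : 'I_n -> k.-tuple A -> A) : k.-tuple A -> A :=
  fun x => f [tuple g i x | i < n].

Definition is_clone (A : Type) (C : set (operation A)) : Prop :=
  [/\ forall f, C f -> 0 < arity f,
      forall (n : nat) (i : 'I_n), C (op (@projection A n i)) &
      forall (n k : nat) (f : n.-tuple A -> A) (g : 'I_n -> k.-tuple A -> A),
        C (op f) -> (forall i, C (op (g i))) -> C (op (composition f g))].

(* Variables are indexed from 0: the exponent [val m i] is that of x_(i+1). *)
Definition monomial : Type := {m : {cmonom nat} | m != mone}.

Definition mI (m : monomial) : nat := \max_(i <- finsupp (val m)) i.+1.

(* Only meaningful for [mI m <= n]: variables beyond the n-th are ignored. *)
Definition induced (F : finFieldType) (m : monomial) (n : nat) :
    n.-tuple F -> F :=
  fun x => (\prod_(i < n) tnth x i ^+ val m i)%R.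

Arguments induced F m n x : clear implicits.

Definition equivalent (F : finFieldType) (m1 m2 : monomial) : Prop :=
  op (induced F m1 (mI m1)) = op (induced F m2 (mI m2)).

Definition induced_ops (F : finFieldType) (M : set monomial) :
    set (operation F) :=
  [set f | exists m n, [/\ M m, mI m <= n & f = op (induced F m n)]].

Arguments induced_ops F M _ : clear implicits.

Definition monomial_clone (F : finFieldType) (M : set monomial) : Prop :=
  is_clone (induced_ops F M) /\
  (forall m1 m2, equivalent F m1 m2 -> M m1 -> M m2).

Definition square_free (n : nat) : Prop := forall d : nat, d ^ 2 %| n -> d = 1.

(* Main.v *)
Require Import Defs.
From HB Require Import structures.
From mathcomp Require Import all_boot all_order all_algebra all_fingroup.
From mathcomp Require Import all_solvable all_field.
From mathcomp Require Import finmap monalg zify.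
From mathcomp Require Import boolp classical_sets.

(** Put [s = q - 1].  On [F] a power map [x ^+ a] only depends on whether
[a = 0] and on [a] modulo [s], so a monomial is, up to equivalence, a vector of
exponents in a finite semiring with [s + 1] elements.  Composing monomials
substitutes such vectors into each other.

If [s] has a square factor, write [s = d * c * d] with [d > 1] and put
[r = d * c].  Then [r] is nonzero but squares to zero modulo [s].  Substituting
a monomial whose exponents are multiples of [r] into another one of that kind
yields exponents divisible by [s]: only variables that were substituted
directly keep an exponent that is nonzero modulo [s].  So a bound [N] on the
number of such variables is preserved by composition, and increasing [N] gives
an infinite chain; the monomial [(x_1 ... x_(N+1))^r] separates consecutive
members.  This is [tower_clone] and [tower_proper].

If [s] is square-free, every [a] satisfies [a ^ l.+1 = a] modulo [s] for some
[l > 0] ([square_free_period]).  Suppose that a clone contains a monomial with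
two variables of the same exponent [a].  Iterating it in these two places gives
[x^b z^b y^w] with [b] a power of [a] such that [b * a = a] modulo [s].  Used
inside an [a]-th power, it turns the variable [x] into the product [x z], at the
cost of a factor [y^(w * a)]; doing so a multiple of [s] times with [y = x]
makes these factors disappear ([spread_var]).  Hence, as soon as an exponent
occurs at least twice, the number of its occurrences may be increased by any
multiple of [s] ([clone_pump]).  The relation [pumps] on tuples of occurrence
numbers expressing this is a well-quasi-order by Dickson's lemma
([pumps_wqo]).  In a strictly ascending chain choose a new monomial at each
step: two of these monomials are related, so the later one is generated by the
earlier one and is not new, a contradiction ([square_free_stabilizes]). *)

Set Implicit Arguments.
Unset Strict Implicit.
Unset Printing Implicit Defensive.

Local Open Scope classical_set_scope.

(** * Exponents modulo the order of the multiplicative group *)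

(** With [g = gcdn s a], square-freeness makes [a] coprime to [s %/ g], so
Euler's theorem gives the period modulo [s %/ g], and the factor [a] itself
takes care of [g]. *)
Lemma square_free_period (s : nat) (s_gt0 : 0 < s) (s_sf : square_free s)
    (a : nat) : exists2 l, 0 < l & a ^ l.+1 = a %[mod s].
Proof.
pose g := gcdn s a; pose h := s %/ g.
have sE : s = (g * h)%N by rewrite mulnC divnK ?dvdn_gcdl.
have h_gt0 : 0 < h by move: s_gt0; rewrite sE muln_gt0 => /andP[].
have co_ah : coprime a h.
  rewrite /coprime; apply/eqP; set d := gcdn a h.
  have dg : d %| g.
    by rewrite dvdn_gcd dvdn_gcdl andbT sE dvdn_mull // dvdn_gcdr.
  by apply: s_sf; rewrite sE -mulnn dvdn_mul // dvdn_gcdr.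
exists (totient h); first by rewrite totient_gt0.
apply/eqP; rewrite eqn_mod_dvd; last first.
  case: (posnP a) => [->|a_gt0]; first by [].
  by rewrite -{1}(expn1 a) leq_pexp2l.
rewrite expnS -[X in _ - X]muln1 -mulnBr [X in X %| _]sE dvdn_mul ?dvdn_gcdr //.
have [a0|a_gt0] := posnP a.
  move: co_ah; rewrite a0 /coprime gcd0n => /eqP ->; exact: dvd1n.
by rewrite -eqn_mod_dvd ?expn_gt0 ?a_gt0 //; apply/eqP/Euler_exp_totient.
Qed.

Definition exp_equiv (s a b : nat) : Prop :=
  (a == 0) = (b == 0) /\ a = b %[mod s].

Lemma exp_equiv_sym s a b : exp_equiv s a b -> exp_equiv s b a.
Proof. by case. Qed.

Lemma dvdn_exp_equiv d s a b : d %| s -> exp_equiv s a b -> (d %| a) = (d %| b).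
Proof.
by move=> ds [_ ab]; rewrite /dvdn -(modn_dvdm a ds) ab modn_dvdm.
Qed.

Definition reduced_exp (s a : nat) : 'I_s.+1 :=
  inord (if a == 0 then 0 else (a.-1 %% s).+1).

Lemma reduced_expP s a : 0 < s -> exp_equiv s a (reduced_exp s a).
Proof.
move=> s_gt0; rewrite /reduced_exp inordK; last first.
  by case: eqP => //; rewrite ltnS ltn_pmod.
by split; case: a => //= a; rewrite -addn1 -[in RHS]addn1 modnDml.
Qed.

(** Evaluating at [0] detects whether an exponent vanishes; evaluating at a
generator of the cyclic group of units detects its residue. *)
Lemma exp_equivP (F : finFieldType) (a b : nat) :
  (forall x : F, x ^+ a = x ^+ b)%R <-> exp_equiv #|F|.-1 a b.
Proof.
split=> [ab | [ab0 abs] x].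
  split.
    have := ab 0%R; rewrite !GRing.expr0n; do 2 case: eqP => // _; move/eqP;
      by rewrite ?GRing.oner_eq0 // eq_sym GRing.oner_eq0.
  have /cyclicP[u uG] := field_unit_group_cyclic [set: {unit F}]%G.
  have <- : #[u]%g = #|F|.-1 by rewrite -card_finField_unit orderE -uG.
  apply/eqP; rewrite -eq_expg_mod_order; apply/eqP/val_inj.
  by rewrite !FinRing.val_unitX; exact: ab.
have [-> | xN0] := eqVneq x 0%R; first by rewrite !GRing.expr0n ab0.
have x1 : (x ^+ #|F|.-1 = 1)%R.
  apply: (GRing.mulfI xN0); rewrite -GRing.exprS GRing.mulr1.
  rewrite prednK ?expf_card //.
  by apply/card_gt0P; exists 0%R.
have red c : (x ^+ c = x ^+ (c %% #|F|.-1))%R.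
  by rewrite {1}(divn_eq c #|F|.-1) GRing.exprD mulnC GRing.exprM x1
    GRing.expr1n GRing.mul1r.
by rewrite red abs -red.
Qed.

Lemma card_finField_gt1 (F : finFieldType) : 1 < #|F|.
Proof.
by apply/card_gt1P; exists 0%R, 1%R; rewrite eq_sym GRing.oner_eq0.
Qed.

(** * Dickson's lemma and the pumping order *)

Definition unbounded (X : nat -> Prop) := forall n, exists2 m, n <= m & X m.

Definition nondecreasing_on (X : nat -> Prop) (f : nat -> nat) :=
  forall i j, X i -> X j -> i <= j -> f i <= f j.

(** The indices whose value is minimal among all later ones in [X]: there are
infinitely many, because each tail of [X] attains its minimum. *)
Lemma valleys (X : nat -> Prop) (f : nat -> nat) : unbounded X ->
  exists Y, [/\ unbounded Y, forall i, Y i -> X i & nondecreasing_on Y f].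
Proof.
move=> Xinf.
exists (fun i => X i /\ forall j, X j -> i <= j -> f i <= f j); split.
- move=> n.
  pose P v := `[< exists i, [/\ n <= i, X i & f i = v] >].
  have exP : exists v, P v.
    by have [m nm Xm] := Xinf n; exists (f m); apply/asboolP; exists m.
  case: (ex_minnP exP) => v /asboolP[i [ni Xi fi]] vmin.
  exists i => //; split=> // j Xj ij; rewrite fi; apply: vmin.
  by apply/asboolP; exists j; split=> //; apply: leq_trans ij.
- by move=> i [].
- by move=> i j [_ Yi] [Xj _] ij; apply: Yi.
Qed.

(** Taking valleys successively for each of the finitely many sequences. *)
Lemma dickson (T : finType) (f : T -> nat -> nat) :
  exists i j, i < j /\ forall t, f t i <= f t j.
Proof.
suff [Y [Yinf Yf]] : exists Y, unbounded Y /\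
    forall t, t \in enum T -> nondecreasing_on Y (f t).
  have [i _ Yi] := Yinf 0; have [j ij Yj] := Yinf i.+1.
  by exists i, j; split=> // t; apply: Yf; rewrite ?mem_enum // ltnW.
elim: (enum T) => [|t ts [X [Xinf Xf]]].
  by exists (fun=> True); split=> // n; exists n.
have [Y [Yinf YX Yf]] := valleys (f t) Xinf.
exists Y; split=> // t'; rewrite inE => /predU1P[-> //|t'ts] i j Yi Yj.
by apply: Xf => //; exact: YX.
Qed.

(** For square-free [s], a clone with a monomial in which some exponent occurs [c]
times contains the monomial in which it occurs [c'] times instead. *)
Definition pumps (s c c' : nat) : Prop :=
  c = c' \/ [/\ 1 < c, c <= c' & c = c' %[mod s]].

(** Each count [c] is replaced by four monotone constraints: besides [c], the
decreasing quantity [2 - c] preserves the distinction between 0, 1 and larger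
values, and the pair [c %% s], [s - c %% s] can only grow simultaneously if the
residue is constant. *)
Lemma pumps_wqo (s : nat) (T : finType) (c : nat -> T -> nat) : 0 < s ->
  exists i j, i < j /\ forall t, pumps s (c i t) (c j t).
Proof.
move=> s_gt0.
have [i [j [ij cij]]] := dickson (fun (p : T * 'I_4) i =>
  nth 0 [:: c i p.1; 2 - c i p.1; c i p.1 %% s; s - c i p.1 %% s] p.2).
exists i, j; split=> // t; rewrite /pumps.
have := cij (t, @Ordinal 4 0 isT); have := cij (t, @Ordinal 4 1 isT).
have := cij (t, @Ordinal 4 2 isT); have := cij (t, @Ordinal 4 3 isT) => /=.
have := ltn_pmod (c i t) s_gt0; have := ltn_pmod (c j t) s_gt0.
move: (c i t) (c j t) => x y lt1 lt2 d3 d2 d1 d0.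
have E : x = y %[mod s] by lia.
have [c1|c2] := leqP x 1; [left; lia | right; split=> //].
Qed.

(** * Pumping exponents inside a clone *)

Definition powprod (F : finFieldType) (n : nat) (e : 'I_n -> nat) :
    n.-tuple F -> F :=
  fun x => (\prod_(i < n) tnth x i ^+ e i)%R.

Section Pumping.

Variables (F : finFieldType) (C : set (operation F)).
Hypothesis C_clone : is_clone C.

Variables (n : nat) (e : 'I_n -> nat).
Hypothesis Ce : C (op (powprod (F := F) e)).
Variable k : nat.

Implicit Types f g h : k.-tuple F -> F.

Lemma clone_subst (g : 'I_n -> k.-tuple F -> F) : (forall i, C (op (g i))) ->
  C (op (fun x => \prod_(i < n) g i x ^+ e i)%R).
Proof.
case: C_clone => _ _ comp Cg; have := comp _ _ _ _ Ce Cg.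
suff -> : composition (powprod e) g =
  fun x => (\prod_(i < n) g i x ^+ e i)%R by [].
by apply/funext=> x; apply: eq_bigr => i _; rewrite tnth_mktuple.
Qed.

(** Identify all variables other than the two with exponent [a]. *)
Lemma double_var i1 i2 a : i1 != i2 -> e i1 = a -> e i2 = a ->
  exists w, forall f g h, C (op f) -> C (op g) -> C (op h) ->
    C (op (fun x => f x ^+ a * g x ^+ a * h x ^+ w)%R).
Proof.
move=> i12 e1 e2.
exists (\sum_(i | (i != i1) && (i != i2)) e i) => f g h Cf Cg Ch.
pose sub i := if i == i1 then f else if i == i2 then g else h.
have := clone_subst (g := sub); rewrite /sub.
have -> : (fun x => \prod_(i < n) sub i x ^+ e i)%R =
    (fun x => f x ^+ a * g x ^+ a *
       h x ^+ \sum_(i | (i != i1) && (i != i2)) e i)%R.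
  apply/funext=> x; rewrite (bigD1 i1) //= (bigD1 i2) 1?eq_sym //=.
  rewrite /sub !eqxx eq_sym (negPf i12) e1 e2 GRing.mulrA -GRing.prodrXr.
  by congr (_ * _)%R; apply: eq_bigr => i /andP[/negPf-> /negPf->].
by apply=> i; case: (i == i1); case: (i == i2).
Qed.

(** Substitute the monomial for its own first variable, using [h] for all other
places; the exponent collected by [h] does not depend on [f], [g], [h]. *)
Lemma double_var_iter i1 i2 a l : i1 != i2 -> e i1 = a -> e i2 = a ->
  exists w, forall f g h, C (op f) -> C (op g) -> C (op h) ->
    C (op (fun x => f x ^+ (a ^ l.+1) * g x ^+ (a ^ l.+1) * h x ^+ w)%R).
Proof.
move=> i12 e1 e2; have [w Cw] := double_var i12 e1 e2.
elim: l => [|l [v Cv]]; first by exists w.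
exists (v * a + a + w)%N => f g h Cf Cg Ch.
have := Cw _ _ _ (Cv _ _ _ Cf Cg Ch) Ch Ch.
set lhs := (fun _ => _) => Clhs; set rhs := (fun _ => _).
suff <- : lhs = rhs by [].
apply/funext=> x; rewrite /lhs /rhs !GRing.exprMn -!GRing.exprM.
by rewrite !GRing.exprD !GRing.mulrA (expnSr a l.+1).
Qed.

Let s := #|F|.-1.
Hypothesis s_sf : square_free s.

(** Inside an [a]-th power, one variable [v] can be replaced by the product of
[v] and [vs].  Each new factor costs a power [u * a] of some variable; taking
[v] for it every time, the total cost is a multiple of [size vs], hence of [s],
and is absorbed by [v ^+ a]. *)
Lemma spread_var i1 i2 a (v : 'I_k) (vs : seq 'I_k) :
    i1 != i2 -> e i1 = a -> e i2 = a -> s %| size vs ->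
  exists2 f, C (op f) &
    forall x, (f x ^+ a = \prod_(w <- v :: vs) tnth x w ^+ a)%R.
Proof.
move=> i12 e1 e2 s_vs.
have s_gt0 : 0 < s by have := card_finField_gt1 F; rewrite /s; lia.
have [[//|l] _ al] := square_free_period s_gt0 s_sf a.
have [u Cu] := double_var_iter l i12 e1 e2.
have pow_a y : (y ^+ (a ^ l.+1 * a) = y ^+ a :> F)%R.
  apply/exp_equivP: y; split; last by rewrite -expnSr.
  by rewrite muln_eq0 expn_eq0 /=; case: eqP.
have [_ proj _] := C_clone.
have [f Cf fE] : exists2 f, C (op f) & forall x, (f x ^+ a =
    (\prod_(w <- vs) tnth x w ^+ a) * tnth x v ^+ (a + size vs * (u * a)))%R.
  elim: vs {s_vs} => [|w vs [f Cf fE]].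
    by exists (projection v) => // x; rewrite big_nil GRing.mul1r addn0.
  exists (fun x => f x ^+ (a ^ l.+1) * projection w x ^+ (a ^ l.+1)
                   * projection v x ^+ u)%R; first exact: Cu.
  move=> x; rewrite !GRing.exprMn -!GRing.exprM !pow_a fE big_cons /= mulSn.
  rewrite /projection addnCA [in RHS]addnC !GRing.exprD !GRing.mulrA.
  by congr (_ * _)%R; rewrite GRing.mulrC !GRing.mulrA.
exists f => // x; rewrite fE big_cons GRing.mulrC; congr (_ * _)%R.
apply/exp_equivP: (tnth x v); split; first by case: (a); lia.
by rewrite -modnDmr (eqP (dvdn_mulr _ s_vs)) addn0.
Qed.

(** The head of [L] absorbs the whole surplus of [L'], a prefix of length one
modulo [s]; the tail is matched one to one with the remaining variables. *)
Lemma pump_class a (L : seq 'I_n) (L' : seq 'I_k) : uniq L ->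
    (forall i, i \in L -> e i = a) -> pumps s (size L) (size L') ->
  exists f : 'I_n -> k.-tuple F -> F, forall i, i \in L -> C (op (f i)) /\
    forall x, (\prod_(i <- L) f i x ^+ a = \prod_(w <- L') tnth x w ^+ a)%R.
Proof.
have [_ proj _] := C_clone.
case: L => [|i0 L0] /=; first by exists (fun _ _ => 1%R).
case/andP=> i0L0 uL0 eL pLL'.
have szL' : size L0 < size L' by case: pLL' => [<-|[]].
move: pLL'; rewrite -[in pumps _ _ _](cat_take_drop (size L' - size L0) L').
set P := take _ L'; set Q := drop _ L'.
have szQ : size Q = size L0 by rewrite size_drop subKn // ltnW.
have : 0 < size P by rewrite size_takel ?leq_subr // subn_gt0.
have <- : P ++ Q = L' by exact: cat_take_drop.
clearbody P Q; case: P => [//|v vs _].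
rewrite size_cat szQ /= => pLL'.
have [f0 Cf0 f0E] : exists2 f, C (op f) &
    forall x, (f x ^+ a = \prod_(w <- v :: vs) tnth x w ^+ a)%R.
  case: pLL' => [szvs | [szL _ smod]].
    have -> : vs = [::] by apply: size0nil; lia.
    by exists (projection v) => // x; rewrite big_seq1.
  case: L0 => [//|i1 L1] in i0L0 uL0 eL szL szL' szQ smod *.
  apply: (spread_var (i1 := i0) (i2 := i1)).
  - by apply: contraNneq i0L0 => ->; rewrite mem_head.
  - by apply: eL; rewrite mem_head.
  - by apply: eL; rewrite !inE eqxx orbT.
  have := smod; rewrite addSn -addnS => /eqP.
  rewrite eq_sym eqn_mod_dvd ?leq_addl //.
  by rewrite addnK.
exists (fun i => if i == i0 then f0 else projection (nth v Q (index i L0))).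
move=> i iL; split=> [|x]; first by case: eqP.
rewrite big_cons eqxx f0E -cat_cons big_cat; congr (_ * _)%R.
have QE : Q = [seq nth v Q (index i L0) | i <- L0].
  apply: (@eq_from_nth _ v); rewrite ?size_map // => j; rewrite szQ => jL0.
  by rewrite (nth_map i0) // index_uniq.
rewrite [in RHS]QE big_map big_seq [LHS]big_seq; apply: eq_bigr => j jL0.
by rewrite ifN //; apply: contraNneq i0L0 => <-.
Qed.

End Pumping.

Definition class_count (n N : nat) (e : 'I_n -> 'I_N) (a : 'I_N) : nat :=
  size (enum [pred i | e i == a]).

(** A composition replaces every variable at once and the requirement on the
substitutes can be met for each exponent separately, so all exponents are pumped
by a single composition. *)
Lemma clone_pump (F : finFieldType) (C : set (operation F)) (n k N : nat)
    (e : 'I_n -> 'I_N) (e' : 'I_k -> 'I_N) :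
  is_clone C -> square_free #|F|.-1 ->
  (forall a, pumps #|F|.-1 (class_count e a) (class_count e' a)) ->
  C (op (powprod (F := F) e)) -> C (op (powprod (F := F) e')).
Proof.
move=> C_clone s_sf pump Ce.
have [a | f fP] := fin_all_exists (P :=
    fun (a : 'I_N) (f : 'I_n -> k.-tuple F -> F) =>
    forall i, i \in enum [pred i | e i == a] -> C (op (f i)) /\ forall x,
      (\prod_(i <- enum [pred i | e i == a]) f i x ^+ a =
       \prod_(w <- enum [pred w | e' w == a]) tnth x w ^+ a)%R).
  apply: (pump_class C_clone Ce s_sf); [exact: enum_uniq | | exact: pump].
  by move=> i; rewrite mem_enum => /eqP ->.
have fC i : C (op (f (e i) i)) by case: (fP (e i) i) => //; rewrite mem_enum !inE.
have := clone_subst C_clone Ce fC.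
congr (C (op _)); apply/funext => x; rewrite /powprod.
rewrite (partition_big e predT) // [RHS](partition_big e' predT) //=.
apply: eq_bigr => a _.
transitivity (\prod_(i <- enum [pred i | e i == a]) f a i x ^+ a)%R.
  by rewrite big_enum; apply: eq_bigr => i /eqP ->.
transitivity (\prod_(w <- enum [pred w | e' w == a]) tnth x w ^+ a)%R; last first.
  by rewrite big_enum; apply: eq_bigr => i /eqP ->.
case La: (enum [pred i | e i == a]) => [|i L].
  have := pump a; rewrite /class_count La.
  by case=> [/esym/size0nil-> | []]; rewrite ?big_nil.
by rewrite -La; case: (fP a i) => //; rewrite La mem_head.
Qed.

Lemma clone_ext (F : finFieldType) (C : set (operation F)) n
    (e e' : 'I_n -> nat) :
  (forall i, exp_equiv #|F|.-1 (e i) (e' i)) ->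
  C (op (powprod (F := F) e)) -> C (op (powprod (F := F) e')).
Proof.
move=> ee'; congr (C (op _)); apply/funext=> x; apply: eq_bigr => i _.
by apply: (exp_equivP F _ _).2.
Qed.

(** * Monomials and their exponents *)

Lemma monomial_exps_gt (m : monomial) i : mI m <= i -> val m i = 0.
Proof.
move=> mi; apply/eqP; rewrite cmE_eq0; apply: contraTN mi => im.
rewrite -ltnNge /mI; exact: (leq_bigmax_seq (F := fun i => i.+1)).
Qed.

Lemma mI_leq (m : monomial) n : (forall i, n <= i -> val m i = 0) -> mI m <= n.
Proof.
move=> mn; apply/bigmax_leqP_seq => i im _; rewrite ltnNge.
by apply: contraTN im => ni; rewrite -cmE_eq0 mn.
Qed.

Lemma mI_gt0 (m : monomial) : 0 < mI m.
Proof.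
rewrite lt0n; apply: contraNneq (valP m) => m0; apply/cmP => i.
by rewrite cm1 monomial_exps_gt // m0.
Qed.

Lemma mI_last (m : monomial) : val m (mI m).-1 != 0.
Proof.
apply/eqP => m0; have := mI_gt0 m; rewrite -[0 < _]negbK => /negP; apply.
rewrite -leqNgt -ltnS; case E: (mI m) => [//|n]; rewrite E /= in m0.
suff : mI m <= n by rewrite E ltnn.
apply: mI_leq => i; rewrite leq_eqVlt => /predU1P[<- //|ni].
by apply: monomial_exps_gt; rewrite E.
Qed.

Lemma induced_eq (F : finFieldType) (m1 m2 : monomial) n :
  mI m1 <= n -> mI m2 <= n ->
  induced F m1 n = induced F m2 n ->
  forall i, exp_equiv #|F|.-1 (val m1 i) (val m2 i).
Proof.
move=> m1n m2n m12 i; have [ni|i_n] := leqP n i.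
  by rewrite !monomial_exps_gt // (leq_trans _ ni).
apply/exp_equivP => y.
pose t := [tuple if j == i :> nat then y else 1%R | j < n].
have ev (m : monomial) : (induced F m n t = y ^+ val m i)%R.
  rewrite /induced (bigD1 (Ordinal i_n)) //= tnth_mktuple eqxx.
  rewrite big1 ?GRing.mulr1 // => j /negPf ji.
  by rewrite tnth_mktuple -val_eqE /= in ji *; rewrite ji GRing.expr1n.
by rewrite -!ev m12.
Qed.

Lemma op_inj (A : Type) n (f g : n.-tuple A -> A) : op f = op g -> f = g.
Proof. exact: (Eqdep_dec.inj_pair2_eq_dec _ PeanoNat.Nat.eq_dec). Qed.

Lemma op_induced_eq (F : finFieldType) (m1 m2 : monomial) n1 n2 :
  mI m1 <= n1 -> mI m2 <= n2 ->
  op (induced F m1 n1) = op (induced F m2 n2) ->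
  n1 = n2 /\ forall i, exp_equiv #|F|.-1 (val m1 i) (val m2 i).
Proof.
move=> m1n m2n m12; have n12 := congr1 (@arity F) m12; split=> //.
rewrite /arity /= in n12; rewrite -n12 in m2n m12.
exact: (induced_eq m1n m2n (op_inj m12)).
Qed.

Lemma equivalentP (F : finFieldType) (m1 m2 : monomial) :
  equivalent F m1 m2 <-> forall i, exp_equiv #|F|.-1 (val m1 i) (val m2 i).
Proof.
split=> [m12 | m12]; first by have [] := op_induced_eq (leqnn _) (leqnn _) m12.
have mI12 : mI m1 = mI m2.
  apply/eqP; rewrite eqn_leq; apply/andP; split; apply: mI_leq => i mi; apply/eqP.
    by rewrite (m12 i).1 monomial_exps_gt.
  by rewrite -(m12 i).1 monomial_exps_gt.
rewrite /equivalent -mI12; congr (op _); apply/funext => x.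
by apply: eq_bigr => i _; apply/exp_equivP: (tnth x i).
Qed.

Lemma monomial_of_exps (e : nat -> nat) n :
  (forall i, n <= i -> e i = 0) -> (exists i, e i != 0) ->
  exists m : monomial, forall i, val m i = e i.
Proof.
move=> en [i0 ei0].
pose c : {cmonom nat} :=
  mkcmonom [fsfun i in [fset i | i in iota 0 n]%fset => e i | 0]%fset.
have cE i : c i = e i.
  rewrite /c cmE /= fsfun_fun; case: imfsetP => // in_n.
  have [/en-> //|lt_in] := leqP n i.
  by case: in_n; exists i => //=; rewrite mem_iota.
have c1 : c != mone.
  by apply: contraNneq ei0 => c0; rewrite -cE c0 cm1.
by exists (exist _ c c1).
Qed.

(** * Chains stabilize in the square-free case *)

Lemma square_free_stabilizes (F : finFieldType) (M : nat -> set monomial) :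
  square_free #|F|.-1 -> (forall i, monomial_clone F (M i)) ->
  ~ (forall i, M i `<` M i.+1).
Proof.
move=> s_sf clM ltM.
have s_gt0 : 0 < #|F|.-1 by have := card_finField_gt1 F; lia.
have subM i j : i <= j -> M i `<=` M j.
  elim: j => [|j IH]; first by rewrite leqn0 => /eqP ->.
  rewrite leq_eqVlt => /predU1P[-> //|/IH]; move/subset_trans; apply.
  by case: (ltM j).
have [i | m mP] := choice (P := fun i m => M i.+1 m /\ ~ M i m).
  case: (ltM i) => _ /existsNP[m /not_implyP ?]; by exists m.
pose e j (i : 'I_(mI (m j))) := reduced_exp #|F|.-1 (val (m j) i).
have [i [j [ij pump]]] := pumps_wqo (fun j a => class_count (e j) a) s_gt0.
have [clone_j closed_j] := clM j.
(* The monomial [m j] that is new at step [j.+1] already belongs to [M j]. *)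
have : induced_ops F (M j) (op (powprod (F := F) (e j))).
  apply: (clone_pump clone_j s_sf pump).
  apply: (clone_ext (e := fun l : 'I_(mI (m i)) => val (m i) l)).
    by move=> l; exact: reduced_expP.
  exists (m i), (mI (m i)); split=> //.
  exact: (subM i.+1 j ij _ (mP i).1).
move/(clone_ext (e' := fun l : 'I_(mI (m j)) => val (m j) l)).
case=> [l | m' [n [Mm' m'n mm']]]; first exact/exp_equiv_sym/reduced_expP.
apply: (mP j).2; apply: closed_j Mm'; apply/equivalentP => l.
by have [_] := op_induced_eq (leqnn _) m'n mm' => /(_ l);
  exact: exp_equiv_sym.
Qed.

(** * An infinite chain when a square divides the order *)

(** The first alternative describes the projections.  In the second, the list [t]
bounds the number of variables whose exponent is nonzero modulo [s]; for [r]
with square zero modulo [s], composition cannot increase this number. *)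
Definition tower (s r N : nat) : set monomial :=
  [set m : monomial |
    (exists i, exp_equiv s (val m i) 1 /\ forall j, j != i -> val m j = 0) \/
    ((forall i, r %| val m i) /\
     exists2 t : seq nat, size t <= N &
       forall i, i \notin t -> s %| val m i)].

Lemma powprod_comp (F : finFieldType) n k (e : 'I_n -> nat)
    (b : 'I_n -> 'I_k -> nat) :
  composition (powprod (F := F) e) (fun i => powprod (F := F) (b i)) =
  powprod (F := F) (fun j => \sum_(i < n) b i j * e i)%N.
Proof.
apply/funext => x; rewrite /composition /powprod.
under eq_bigr => i _ do rewrite tnth_mktuple -GRing.prodrXl.
rewrite exchange_big; apply: eq_bigr => j _ /=.
by rewrite -GRing.prodrXr; apply: eq_bigr => i _; rewrite GRing.exprM.
Qed.

(** In a composition, a term [b i j * m i] with both factors divisible by [r]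
vanishes modulo [s].  What remains comes from the at most [N] indices [i] with
[m i] nonzero modulo [s], each of which contributes to at most one variable [j]:
the one with an exponent not divisible by [r] when [b i] is a projection. *)
Lemma tower_clone (F : finFieldType) (r N : nat) : let s := #|F|.-1 in
  r %| s -> s %| r * r -> monomial_clone F (tower s r N).
Proof.
move=> s rs srr; split; last first.
  move=> m1 m2 /equivalentP m12 [[i [m1i m1j]] | [rm1 [t tN tm1]]]; [left | right].
    exists i; split=> [|j /m1j m1j0].
      by split; [rewrite -(m12 i).1 m1i.1 | rewrite -(m12 i).2 m1i.2].
    by apply/eqP; rewrite -(m12 j).1 m1j0.
  split=> [i|]; first by rewrite -(dvdn_exp_equiv rs (m12 i)).
  by exists t => // i /tm1; rewrite (dvdn_exp_equiv (dvdnn _) (m12 i)).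
split.
- by move=> f [m [n [_ mn ->]]]; apply: leq_trans mn; exact: mI_gt0.
- move=> n i; have [| | m mE] := @monomial_of_exps (fun j => (j == i :> nat) : nat) n.
  + by move=> j nj; case: eqP => // ji; have := ltn_ord i; rewrite -ji ltnNge nj.
  + by exists i; rewrite eqxx.
  exists m, n; split.
  + left; exists (val i); split=> [|j /negPf ji]; last by rewrite mE ji.
    by rewrite mE eqxx.
  + apply: mI_leq => j nj; rewrite mE; case: eqP => // ji.
    by have := ltn_ord i; rewrite -ji ltnNge nj.
  congr (op _); apply/funext => x; rewrite /induced (bigD1 i) //= mE eqxx.
  by rewrite big1 ?GRing.mulr1 // => j /negPf ji; rewrite mE val_eqE ji.
move=> n k f g [m [n' [Mm mn' fE]]] Mg.
have n'E := congr1 (@arity F) fE; rewrite /arity /= in n'E.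
rewrite -{n'}n'E in mn' fE; have {f fE}-> := op_inj fE.
have [i | b bP] := fin_all_exists (P := fun (i : 'I_n) (b : monomial) =>
    [/\ tower s r N b, mI b <= k & g i = induced F b k]).
  have [b [k' [Mb bk' gE]]] := Mg i; exists b.
  have k'E := congr1 (@arity F) gE; rewrite /arity /= in k'E.
  by rewrite -{k'}k'E in bk' gE; split=> //; exact: op_inj gE.
have -> : g = fun i => powprod (fun j : 'I_k => val (b i) j).
  by apply/funext => i; case: (bP i).
rewrite (powprod_comp F (fun i : 'I_n => val m i)).
have Mb i : tower s r N (b i) by case: (bP i).
have bk i : mI (b i) <= k by case: (bP i).
clear g Mg bP.
pose E j := (\sum_(i < n) val (b i) j * val m i)%N.
have Ek j : k <= j -> E j = 0.
  move=> kj; rewrite /E big1 // => i _; rewrite monomial_exps_gt //.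
  exact: leq_trans kj.
have [|h hE] := monomial_of_exps Ek.
  have mn : (mI m).-1 < n by rewrite prednK ?mI_gt0.
  exists (mI (b (Ordinal mn))).-1; rewrite /E (bigD1 (Ordinal mn)) //=.
  by rewrite addn_eq0 negb_and muln_eq0 negb_or !mI_last.
have hk : mI h <= k by apply: mI_leq => j kj; rewrite hE Ek.
exists h, k; split=> //; last first.
  by congr (op _); apply/funext => x; apply: eq_bigr => j _; rewrite hE.
case: Mm => [[i [mi mj]] | [rm [t tN tm]]].
  have i_n : i < n.
    rewrite ltnNge; apply/negP => ni; case: mi => + _.
    by rewrite monomial_exps_gt // (leq_trans mn').
  have hb j : exp_equiv s (val h j) (val (b (Ordinal i_n)) j).
    rewrite hE /E (bigD1 (Ordinal i_n)) //= big1 ?addn0 => [|l li]; last first.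
      by rewrite mj ?muln0 //; apply: contraNneq li => li; apply/eqP/val_inj.
    split; first by rewrite muln_eq0 mi.1 orbF.
    by rewrite -modnMmr mi.2 modnMmr muln1.
  case: (Mb (Ordinal i_n)) => [[j [bj bl]] | [rb [t tN tb]]]; [left | right].
    exists j; split=> [|l /bl bl0]; last by apply/eqP; rewrite (hb l).1 bl0.
    by split; [rewrite (hb j).1 bj.1 | rewrite (hb j).2 bj.2].
  split=> [l|]; first by rewrite (dvdn_exp_equiv rs (hb l)).
  by exists t => // l /tb; rewrite (dvdn_exp_equiv (dvdnn _) (hb l)).
right; split=> [j|]; first by rewrite hE dvdn_sum // => i _; rewrite dvdn_mull.
have bvar (i : 'I_n) : exists p, forall j, j != p -> r %| val (b i) j.
  case: (Mb i) => [[p [_ bp]] | [rb _]]; last by exists 0.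
  by exists p => j /bp ->; exact: dvdn0.
have [p pP] := fin_all_exists bvar.
exists [seq p i | i <- enum 'I_n & val i \in t].
  rewrite size_map (leq_trans _ tN) // -(size_map val).
  apply: uniq_leq_size; first by rewrite (map_inj_uniq val_inj) filter_uniq ?enum_uniq.
  by move=> _ /mapP[i + ->]; rewrite mem_filter => /andP[].
move=> j jt; rewrite hE dvdn_sum // => i _.
have [it | it] := boolP (val i \in t); last by rewrite dvdn_mull ?tm.
apply: (dvdn_trans srr); apply: dvdn_mul (rm i); apply: pP.
by apply: contraNneq jt => ->; rewrite map_f // mem_filter it mem_enum.
Qed.

(** The witness is [(x_1 ... x_(N+1))^r]; having at least two variables, it is
no projection. *)
Lemma tower_proper s r N : 0 < N -> ~~ (s %| r) -> tower s r N `<` tower s r N.+1.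
Proof.
move=> N_gt0 sr; split.
  move=> m [mproj | [rm [t tN tm]]]; [by left | right; split=> //].
  by exists t; rewrite // ltnW.
move=> sub; have r_neq0 : r != 0 by apply: contraNneq sr => ->.
have [i Ni | |m mE] :=
  @monomial_of_exps (fun i => if i < N.+1 then r else 0) N.+1.
- by rewrite ltnNge Ni.
- by exists 0.
have : tower s r N m.
  apply: sub; right; split=> [i|].
    by rewrite mE; case: ifP => // _; exact: dvdn0.
  exists (iota 0 N.+1); first by rewrite size_iota.
  by move=> i; rewrite mem_iota mE /= => /negPf ->; exact: dvdn0.
case=> [[i [_ mj]] | [rm [t tN tm]]].
  (* The boolean [i == 0] is 0 or 1, and always differs from [i]. *)
  have := mj (i == 0); rewrite mE ltnS (leq_trans (leq_b1 _) N_gt0).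
  by move=> r0; rewrite r0 ?eqxx // in r_neq0; case: (i) => [|[]].
have : size (iota 0 N.+1) <= size t.
  apply: uniq_leq_size (iota_uniq _ _) _ => i; rewrite mem_iota /= => iN.
  by apply: contraTT sr => /tm; rewrite mE iN negbK.
by rewrite size_iota leqNgt ltnS tN.
Qed.

Theorem theorem6p6 (p k q : nat) (p_prime : prime p) (k_gt0 : 0 < k)
    (q_eq : q = p ^ k) (F : finFieldType) (cardF : #|F| = q) :
  (exists M : nat -> set monomial,
     (forall i, monomial_clone F (M i)) /\ (forall i, M i `<` M i.+1)) <->
  ~ square_free (q - 1).
Proof.
rewrite -cardF subn1; split=> [[M [clM ltM]] s_sf | ].
  exact: (square_free_stabilizes s_sf clM ltM).
move=> /existsNP[d /not_implyP[/dvdnP[c sE] d1]].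
have := card_finField_gt1 F; have {}sE : #|F|.-1 = d * c * d by rewrite sE; lia.
move=> F1; exists (fun i => tower #|F|.-1 (d * c) i.+1); split=> i.
  apply: tower_clone; rewrite sE; first exact: dvdn_mulr.
  by apply: dvdn_mul => //; exact: dvdn_mulr.
apply: tower_proper => //; apply/negP => /dvdn_leq; rewrite sE; nia.
Qed.
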